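(* Let $(k_n)_{n\ge1}$, $(m_n)_{n\ge1}$ be sequences of natural numbers such that $k_1>1$ and $k_{n+1}>k_n+m_n$ for all $n\in\mathbb{N}$. Put $k_0:=0$, $m_0:=1$, $K_n:=\{k_n,\dots,k_n+m_n-1\}$ for $n\in\mathbb{N}$, and $K:=\bigcup_{n=1}^\infty K_n$. Let $a_1>0$ and for $i>1$ define $$a_i:=\begin{cases} \frac12\,a_{i-1} & \text{if } i-1,i,i+1\notin K, \text{ or } i-1,i\in K,\\[2pt] \frac{2^{m_n}+1}{2^{m_n+1}}\,a_{i-1} & \text{if } i=k_n-1>k_{n-1}+m_{n-1} \text{ for some } n\in\mathbb{N},\\[2pt] \frac{2^{m_n}+1}{2^{m_n+2}}\,a_{i-1} & \text{if } i=k_n-1=k_{n-1}+m_{n-1}\text{ for some } n\in\mathbb{N},\\[2pt] \frac{2^{m_n}}{2^{m_n}+1}\,a_{i-1} & \text{if } i=k_n\text{ for some } n\in\mathbb{N},\\[2pt] \frac14\,a_{i-1} & \text{if } i,i+1\notin K \text{ and } i-1\in K. \end{cases}$$ Then, for every $n\in\mathbb{N}$, $a_n>r_n$ if and only if $n\in K$, where $r_n=\sum_{i=n+1}^\infty a_i$; and the achievement set $E(a_n)=\{\sum_{n\in A}a_n: A\subset\mathbb{N}\}$ is a Cantorval.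
   Context: $\mathbb{N}=\{1,2,3,\dots\}$. A compact and perfect set $D\subset\mathbb{R}$ is a Cantorval if each endpoint of every gap of $D$ (a gap is a component of $\mathbb{R}\setminus D$) is an accumulation point of other gaps of $D$ as well as of nontrivial components of $D$ (components that are not single points). *)

(* Defs.v *)
From HB Require Import structures.
From mathcomp Require Import all_boot all_order all_algebra.
From mathcomp Require Import all_classical all_reals all_analysis.
Import Order.TTheory GRing.Theory Num.Theory.
Import numFieldNormedType.Exports.

Set Implicit Arguments.
Unset Strict Implicit.
Unset Printing Implicit Defensive.

Local Open Scope classical_set_scope.
Local Open Scope ring_scope.

Definition components (R : realType) (A : set R) : set (set R) :=
  [set C | exists2 x, A x & C = connected_component A x].

(* The two unbounded components of the complement are gaps too. *)
Definition gaps (R : realType) (D : set R) : set (set R) := components (~` D).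

Definition nontrivial_components (R : realType) (D : set R) : set (set R) :=
  [set C | components D C /\ ~ exists x, C = [set x]].

(* Only finite endpoints: an unbounded gap has a single one. *)
Definition endpoint (R : realType) (G : set R) (x : R) : Prop :=
  (has_inf G /\ x = inf G) \/ (has_sup G /\ x = sup G).

(* Below, no member of F is {x}, so each neighbourhood of x then contains
   infinitely many members of F. *)
Definition accumulation_point_of_sets (R : realType) (F : set (set R)) (x : R) :
    Prop :=
  forall U : set R, nbhs x U -> exists2 S, F S & S `<=` U.

Definition cantorval (R : realType) (D : set R) : Prop :=
  [/\ compact D, perfect_set D &
      forall G x, gaps D G -> endpoint G x ->
        accumulation_point_of_sets (gaps D `\ G) x /\
        accumulation_point_of_sets (nontrivial_components D) x].

(* Sequences are indexed from 1; the value at 0 plays no role here. *)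
Definition achievement_set (R : realType) (a : nat -> R) : set R :=
  [set x | exists A : set nat,
     (fun n : nat => \sum_(1 <= i < n | i \in A) a i) @ \oo --> x].

(* The remainder r_n = a_{n+1} + a_{n+2} + ..., taken in the extended reals so
   that it is a genuine sum for every nonnegative sequence, without a
   convergence proof. *)
Definition remainder (R : realType) (a : nat -> R) (n : nat) : \bar R :=
  (\sum_(n.+1 <= i <oo) (a i)%:E)%E.

Definition Kblock (k m : nat -> nat) (n : nat) : set nat :=
  [set i | (k n <= i <= k n + m n - 1)%N].

Definition Kset (k m : nat -> nat) : set nat :=
  \bigcup_(n in [set n | (1 <= n)%N]) Kblock k m n.

(* The cases are mutually exclusive and cover all i > 1 when
   k 0 = 0, m 0 = 1, 1 < k 1 and k n + m n < k n.+1 for n >= 1. *)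
Definition K_recurrence (R : realType) (k m : nat -> nat) (a : nat -> R) : Prop :=
  let K := Kset k m in
  forall i : nat, (1 < i)%N ->
  [/\ (~ K i.-1 /\ ~ K i /\ ~ K i.+1) \/ (K i.-1 /\ K i) ->
        a i = 1 / 2 * a i.-1,
      forall n, (1 <= n)%N ->
        i = (k n - 1)%N -> (k n - 1 > k n.-1 + m n.-1)%N ->
        a i = (2 ^+ m n + 1) / 2 ^+ (m n + 1) * a i.-1,
      forall n, (1 <= n)%N ->
        i = (k n - 1)%N -> (k n - 1 = k n.-1 + m n.-1)%N ->
        a i = (2 ^+ m n + 1) / 2 ^+ (m n + 2) * a i.-1,
      forall n, (1 <= n)%N -> i = k n ->
        a i = 2 ^+ m n / (2 ^+ m n + 1) * a i.-1 &
      ~ K i /\ ~ K i.+1 /\ K i.-1 -> a i = 1 / 4 * a i.-1].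

(* Main.v *)
Require Import Defs.
From mathcomp Require Import all_boot all_order all_algebra.
From mathcomp Require Import all_classical all_reals all_analysis.
From mathcomp Require Import zify ring lra.
Import Order.TTheory GRing.Theory Num.Theory.
Import numFieldNormedType.Exports.

Local Open Scope classical_set_scope.
Local Open Scope ring_scope.

(* By induction [a i = C / 2 ^ i * g i], where [g i] is [2] for [i] in [K],
   [1 + 2 ^ - m n] for [i = k n - 1], and [1] otherwise.  Block [n] therefore adds
   exactly [C / 2 ^ (k n - 1)] to the geometric tail, and these excesses after the
   end [p] of a block total at most [2 / 3 * (C / 2 ^ p)]; comparing [a i] with its
   tail is then immediate.

   For the topology, a point of [E] isolated from the left in [E] is a finite sum
   [x], and right of [x] the set [E] is a translate of a set of tail sums. That
   set has gaps [(r_j, a_j)] with [j] in [K] arbitrarily close to [0], so it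
   suffices to find an interval inside each tail set; the symmetry of [E] about
   the midpoint of its hull takes care of points isolated from the right. The
   interval comes from the arithmetic of a block: it is a complete residue
   system, so a run of consecutive lattice points among the partial sums is
   refined by each block, losing only half a lattice unit. *)

(** * Components of subsets of the real line *)
Section RealLineTopology.
Context {R : realType}.
Implicit Types (D C : set R) (x y : R).

Lemma closed_distP D :
  closed D <-> forall x, (forall e, 0 < e -> exists2 y, D y & `|x - y| < e) -> D x.
Proof.
split=> [Dcl x Dx|Dx x clx].
  apply: Dcl => U /nbhs_ballP[e /= e0 eU]; have [y Dy xy] := Dx _ e0.
  by exists y; split=> //; apply: eU.
apply: Dx => e e0; have [|y [Dy xy]] := clx (ball x e); first exact: nbhsx_ballx.
by exists y.
Qed.

Lemma connected_component_itv D x y : x <= y ->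
  (forall z, x <= z <= y -> D z) -> connected_component D x y.
Proof.
move=> xy sD; exists `[x, y]%classic; last by rewrite /= in_itv /= lexx xy.
split; [by rewrite /= in_itv /= lexx xy| |exact: segment_connected].
by move=> z /=; rewrite in_itv /=; exact: sD.
Qed.

Lemma components_itv {D C x y z} : components D C -> C x -> C y ->
  x <= z <= y -> C z.
Proof.
move=> [w Dw ->] Cx Cy; apply: (iffLR (connected_intervalP _)) Cx Cy z.
exact: component_connected.
Qed.

Lemma components_sub {D C} : components D C -> C `<=` D.
Proof. by move=> [w Dw ->]; exact: connected_component_sub. Qed.

Lemma components_nonempty {D C} : components D C -> exists x, C x.
Proof. by move=> [w Dw ->]; exists w; exact: connected_component_refl. Qed.

Lemma components_extend {D C x y} : components D C -> C x ->
  (forall z, Num.min x y <= z <= Num.max x y -> D z) -> C y.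
Proof.
move=> [w Dw ->] Cx sD; apply: connected_component_trans Cx _.
have [xy|/ltW yx] := leP x y.
  by apply: connected_component_itv => // z ?; apply: sD; rewrite min_l ?max_r.
apply: connected_component_sym; apply: connected_component_itv => // z ?.
by apply: sD; rewrite min_r ?max_l.
Qed.

Lemma components_trapped {D C l h x} : components D C -> C x -> ~ D l -> ~ D h ->
  l < x < h -> C `<=` `]l, h[%classic.
Proof.
move=> cC Cx Dl Dh /andP[lx xh] y Cy; rewrite /= in_itv /= !ltNge.
apply/andP; split; apply/negP => yl.
  by apply/Dl/(components_sub cC)/(components_itv cC Cy Cx); rewrite yl ltW.
by apply/Dh/(components_sub cC)/(components_itv cC Cx Cy); rewrite yl ltW.
Qed.

(** If [sup C] were outside [D], the open complement would let [C] extend past its supremum. Points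
    of [C] below [sup C] then show that [sup C] is isolated from the left in [D]. *)
Lemma gap_sup {D C} : closed D -> gaps D C -> has_sup C ->
  D (sup C) /\ exists2 g, g < sup C & forall y, g < y < sup C -> ~ D y.
Proof.
move=> Dcl gC hC; have [g Cg] := components_nonempty gC.
have belowC y : g <= y < sup C -> C y.
  move=> /andP[gy yC]; have [z Cz yz] := sup_gt hC.1 yC.
  by apply: (components_itv gC Cg Cz); rewrite gy ltW.
have DC : D (sup C).
  apply: contrapT => nDC.
  have [e /= e0 eD] : nbhs (sup C) (~` D)
    by apply: open_nbhs_nbhs; split=> //; exact: closed_openC.
  have : C (sup C + e / 2).
    apply: (components_extend gC Cg) => z /andP[zl zu].
    have gS : g <= sup C by apply: ub_le_sup => //; exact: hC.2.
    rewrite min_l in zl; last by lra.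
    rewrite max_r in zu; last by lra.
    have [zC|zC] := ltP z (sup C).
      by apply: (components_sub gC); apply: belowC; rewrite zl.
    by apply: eD => /=; rewrite ler0_norm; lra.
  by move=> /(ub_le_sup hC.2); lra.
split=> //; exists g.
  rewrite lt_neqAle (ub_le_sup hC.2) // andbT.
  by apply/eqP => gE; apply: (components_sub gC _ Cg); rewrite gE.
by move=> y /andP[gy yC]; apply: (components_sub gC); apply: belowC; rewrite ltW.
Qed.

Lemma gap_inf {D C} : closed D -> gaps D C -> has_inf C ->
  D (inf C) /\ exists2 g, inf C < g & forall y, inf C < y < g -> ~ D y.
Proof.
move=> Dcl gC hC; have [g Cg] := components_nonempty gC.
have aboveC y : inf C < y <= g -> C y.
  move=> /andP[yC gy]; have [z Cz yz] := inf_lt hC.1 yC.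
  by apply: (components_itv gC Cz Cg); rewrite gy ltW.
have DC : D (inf C).
  apply: contrapT => nDC.
  have [e /= e0 eD] : nbhs (inf C) (~` D)
    by apply: open_nbhs_nbhs; split=> //; exact: closed_openC.
  have : C (inf C - e / 2).
    apply: (components_extend gC Cg) => z /andP[zl zu].
    have gS : inf C <= g by apply: ge_inf => //; exact: hC.2.
    rewrite min_r in zl; last by lra.
    rewrite max_l in zu; last by lra.
    have [zC|zC] := ltP (inf C) z.
      by apply: (components_sub gC); apply: aboveC; rewrite zC.
    by apply: eD => /=; rewrite ger0_norm; lra.
  by move=> /(ge_inf hC.2); lra.
split=> //; exists g.
  rewrite lt_neqAle (ge_inf hC.2) // andbT.
  by apply/eqP => gE; apply: (components_sub gC _ Cg); rewrite -gE.
by move=> y /andP[yC gy]; apply: (components_sub gC); apply: aboveC; rewrite yC ltW.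
Qed.

End RealLineTopology.

(** * Achievement sets of positive summable sequences *)
Section Subsums.
Context {R : realType}.
Variable a : nat -> R.
Hypothesis a_gt0 : forall i, (0 < i)%N -> 0 < a i.
Hypothesis a_summable : cvgn (series a).

(** The term of index [i] is included, so r_n is [tail_sum n.+1]; the unconstrained [a 0] cancels
    when [i] is positive. *)
Definition tail_sum (i : nat) : R := limn (series a) - series a i.

Lemma tail_sumS i : tail_sum i = a i + tail_sum i.+1.
Proof.
have -> : tail_sum i.+1 = limn (series a) - (series a i + a i).
  by rewrite /tail_sum /series /= big_nat_recr.
by rewrite /tail_sum; ring.
Qed.

Lemma tail_sum_cvg : tail_sum @ \oo --> 0.
Proof.
rewrite -(subrr (limn (series a))); apply: cvgB => //; exact: cvg_cst.
Qed.

(** The difference [tail_sum - u] does not increase from [n] on and tends to [0], so it is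
    nonnegative there. *)
Lemma tail_sum_ge (u : nat -> R) n : u @ \oo --> 0 ->
  (forall i, (n <= i)%N -> u i <= a i + u i.+1) -> u n <= tail_sum n.
Proof.
move=> u0 step; rewrite -subr_ge0.
have drop l : tail_sum (n + l)%N - u (n + l)%N <= tail_sum n - u n.
  elim: l => [|l IHl]; first by rewrite addn0.
  have := step (n + l)%N (leq_addr _ _); rewrite addnS.
  by have := tail_sumS (n + l)%N; lra.
have cvg : (fun i => tail_sum i - u i) @ \oo --> 0.
  by rewrite -(subrr 0); apply: cvgB => //; exact: tail_sum_cvg.
apply: (cvgr_to_le cvg); exists n => // i /= ni.
by rewrite -(subnKC ni); exact: drop.
Qed.

Lemma tail_sum_ge0 i : (0 < i)%N -> 0 <= tail_sum i.
Proof.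
move=> i0; apply: (tail_sum_ge (fun=> 0)); first exact: cvg_cst.
by move=> j ij; rewrite addr0 ltW // a_gt0 // (leq_trans i0).
Qed.

Lemma tail_sum_lt e : 0 < e -> exists N, forall n, (N <= n)%N -> tail_sum n < e.
Proof.
move=> e0; have /cvgr0Pnorm_lt/(_ e e0)[N _ NP] := tail_sum_cvg.
by exists N => n Nn; apply: le_lt_trans (ler_norm _) (NP n Nn).
Qed.

Lemma remainderE n : remainder a n = (tail_sum n.+1)%:E.
Proof.
apply: cvg_lim => //; apply/cvg_EFin.
  by near=> i; rewrite sumEFin.
suff : (fun M => tail_sum n.+1 - tail_sum M) @ \oo --> tail_sum n.+1.
  apply: cvg_trans; apply: near_eq_cvg; exists n.+1 => // M /= nM.
  rewrite sumEFin /= /tail_sum /series /= [X in _ - (_ - X)](big_cat_nat (n := n.+1)) //=; ring.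
rewrite -[X in _ --> X]subr0; apply: cvgB; [exact: cvg_cst|exact: tail_sum_cvg].
Unshelve. all: by end_near.
Qed.

(* [y i] is what remains of [x] once the decisions on the indices below [i]
   have been made; the bounds force [y i] to tend to [0]. *)
Definition subsums (n : nat) : set R :=
  [set x | exists2 y : nat -> R, y n = x & forall i, (n <= i)%N ->
     0 <= y i <= tail_sum i /\ (y i.+1 = y i \/ y i.+1 = y i - a i)].

Lemma subsums_bounds {n x} : subsums n x -> 0 <= x <= tail_sum n.
Proof. by move=> [y <- /(_ n (leqnn n))[]]. Qed.

Lemma subsumsS {n x} : subsums n x -> subsums n.+1 x \/ subsums n.+1 (x - a n).
Proof.
move=> [y <- yP]; have [_ [] <-] := yP n (leqnn n); [left|right];
  by exists y => // i /ltnW; exact: yP.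
Qed.

Lemma subsums_push {n x z} : (0 < n)%N -> subsums n.+1 z -> z = x \/ z = x - a n ->
  subsums n x.
Proof.
move=> n0 [y <- yP] yx; exists (fun i => if (i <= n)%N then x else y i).
  by rewrite leqnn.
move=> i; rewrite leq_eqVlt => /predU1P[<-|ni]; last first.
  have [-> ->] : (i <= n)%N = false /\ (i < n)%N = false by split; lia.
  exact: yP.
rewrite leqnn ltnn; split=> //.
have [/andP[y0 yr] _] := yP n.+1 (leqnn _).
have an := a_gt0 n n0; have rS := tail_sumS n.
by case: yx => yx; rewrite yx in y0 yr; apply/andP; split; lra.
Qed.

Lemma subsums_skip {n x} : (0 < n)%N -> subsums n.+1 x -> subsums n x.
Proof. by move=> n0 /subsums_push; apply=> //; left. Qed.

Lemma subsums_take {n x} : (0 < n)%N -> subsums n.+1 x -> subsums n (x + a n).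
Proof. by move=> n0 /subsums_push; apply=> //; right; rewrite addrK. Qed.

Lemma subsums0 {n} : (0 < n)%N -> subsums n 0.
Proof.
move=> n0; exists (fun=> 0) => // i ni; split; last by left.
by rewrite lexx tail_sum_ge0 // (leq_trans n0).
Qed.

(** A limit of sums stays a limit of sums after at least one of the two decisions on each index;
    making such decisions one after another builds the remainders [y]. *)
Lemma subsums_closed n : closed (subsums n).
Proof.
apply/closed_distP => x clx.
pose P i z := forall e, 0 < e -> exists2 t, subsums i t & `|z - t| < e.
have Pbound i z : P i z -> 0 <= z <= tail_sum i.
  move=> Pz; apply/andP; split; rewrite leNgt; apply/negP => zlt.
    have [|t /subsums_bounds/andP[? ?]] := Pz (- z); first by lra.
    by rewrite ltr_norml => /andP[]; lra.
  have [|t /subsums_bounds/andP[? ?]] := Pz (z - tail_sum i); first by lra.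
  by rewrite ltr_norml => /andP[]; lra.
(* If [z] has distance at least [d] from the sums that skip [a i], any closer sum takes it. *)
have PS i z : P i z -> ~ P i.+1 z -> P i.+1 (z - a i).
  move=> Pz /existsNP[d /not_implyP[d0 nd]] e e0.
  have [|t tP] := Pz (Num.min d e); first by rewrite lt_min d0.
  rewrite lt_min => /andP[zd ze]; case: (subsumsS tP) => tS.
    by case: nd; exists t.
  by exists (t - a i) => //; rewrite opprB addrA subrK.
pose y := fix y l := if l is l'.+1 then
  if pselect (P (n + l')%N.+1 (y l')) then y l' else y l' - a (n + l')%N else x.
have yP l : P (n + l)%N (y l).
  elim: l => [|l IHl]; first by rewrite addn0.
  by rewrite addnS /=; case: pselect => // ?; exact: PS.
exists (fun i => y (i - n)%N); first by rewrite subnn.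
move=> i ni; split; first by apply: Pbound; have := yP (i - n)%N; rewrite subnKC.
by rewrite subSn //= subnKC //; case: pselect => ?; [left|right].
Qed.

(** Reflection swaps the two decisions at every index. *)
Lemma subsums_reflect {n x} : subsums n x -> subsums n (tail_sum n - x).
Proof.
move=> [y <- yP]; exists (fun i => tail_sum i - y i) => // i ni.
have [/andP[y0 yr] yS] := yP i ni; split; first by apply/andP; split; lra.
by have := tail_sumS i; case: yS => ->; [right|left]; lra.
Qed.

(** A set of indices gives the remainders [x] minus its partial sums. Conversely, the indices where
    [y] drops are taken, and [y] tends to [0] because the tails do. *)
Lemma achievement_setE : achievement_set a = subsums 1.
Proof.
apply/seteqP; split => x.
  move=> [A Ax]; pose s n := \sum_(1 <= i < n | i \in A) a i.
  have sS i : (0 < i)%N -> s i.+1 = s i + (if i \in A then a i else 0).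
    by move=> i0; rewrite /s big_mkcond big_nat_recr //= -big_mkcond.
  have yS i : (0 < i)%N -> x - s i.+1 = x - s i \/ x - s i.+1 = x - s i - a i.
    by move=> /sS ->; case: ifP => _; [right|left]; ring.
  exists (fun i => x - s i); first by rewrite /s big_geq ?subr0.
  move=> i i0; split; last exact: yS.
  have smono l : s i <= s (i + l)%N <= s i + tail_sum i - tail_sum (i + l)%N.
    elim: l => [|l /andP[IHl IHr]]; first by rewrite addn0 lexx; lra.
    have il : (0 < i + l)%N by rewrite addn_gt0 i0.
    have := tail_sumS (i + l)%N; have := a_gt0 _ il.
    by rewrite addnS sS //; case: ifP => _ ? ?; apply/andP; split; lra.
  rewrite subr_ge0 lerBlDr; apply/andP; split.
    apply: (cvgr_to_ge Ax); exists i => // M /= iM.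
    by have := smono (M - i)%N; rewrite subnKC // => /andP[].
  apply: (cvgr_to_le Ax); exists i => // M /= iM.
  have := smono (M - i)%N; rewrite subnKC // => /andP[_].
  by have := tail_sum_ge0 M (leq_trans i0 iM); rewrite /s; lra.
move=> [y <- yP]; exists [set i | y i.+1 != y i].
have sE n : \sum_(1 <= i < n.+1 | i \in [set i | y i.+1 != y i]) a i = y 1%N - y n.+1.
  elim: n => [|n IHn]; first by rewrite big_geq // subrr.
  rewrite big_mkcond big_nat_recr //= -big_mkcond /= IHn.
  have [_ yS] := yP n.+1 isT.
  have -> : (n.+1 \in [set i | y i.+1 != y i]) = (y n.+2 != y n.+1).
    by apply/idP/idP => [/set_mem|/mem_set].
  have an := a_gt0 n.+1 isT; have [_ [->|->]] := yP n.+1 isT.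
    by rewrite eqxx /= addr0.
  by case: eqP => [|_ /=]; lra.
have y0 : y @ \oo --> 0.
  apply: (squeeze_cvgr (f := fun=> 0) (h := tail_sum)); [|exact: cvg_cst|exact: tail_sum_cvg].
  by exists 1%N => // i /= i1; have [] := yP i i1.
have : (fun n => y 1%N - y n.+1) @ \oo --> y 1%N - 0.
  by apply: cvgB; [exact: cvg_cst|rewrite cvg_shiftS].
by rewrite subr0 -(funext sE) => cvgS; rewrite -cvg_shiftS.
Qed.

(** The range of indices excludes [M] and grows at its upper end, the direction in which the blocks
    refine a run. *)
Inductive finite_subsum (n : nat) : nat -> R -> Prop :=
| finite_subsum_nil : finite_subsum n n 0
| finite_subsum_skip M s : finite_subsum n M s -> finite_subsum n M.+1 s
| finite_subsum_take M s : finite_subsum n M s -> finite_subsum n M.+1 (s + a M).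

Lemma finite_subsum_leq {n M s} : finite_subsum n M s -> (n <= M)%N.
Proof. by elim=> // {}M {}s _ /leqW. Qed.

Lemma subsums_cat {n M s t} : (0 < n)%N -> finite_subsum n M s -> subsums M t ->
  subsums n (s + t).
Proof.
move=> n0 fs; elim: fs t => [t|{}M {}s fs IHs t tM|{}M {}s fs IHs t tM].
- by rewrite add0r.
- by apply/IHs/subsums_skip => //; exact: leq_trans n0 (finite_subsum_leq fs).
- rewrite -addrA [a M + t]addrC.
  by apply/IHs/subsums_take => //; exact: leq_trans n0 (finite_subsum_leq fs).
Qed.

Lemma subsums_split {n} l {x} : subsums n x ->
  exists2 s, finite_subsum n (n + l) s & subsums (n + l) (x - s).
Proof.
move=> nx; elim: l => [|l [s fs sx]].
  by rewrite addn0; exists 0; [exact: finite_subsum_nil|rewrite subr0].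
rewrite addnS; case: (subsumsS sx) => sS.
  by exists s => //; exact: finite_subsum_skip.
exists (s + a (n + l)%N); first exact: finite_subsum_take.
by rewrite opprD addrA.
Qed.

(** Only finitely many sums exist; the induction takes the least of the distances found for the two
    choices of the last term. *)
Lemma finite_subsum_discrete n M x :
  exists2 d, 0 < d & forall s, finite_subsum n M s -> x < s -> x + d <= s.
Proof.
have nil_discrete z : exists2 d : R, 0 < d & z < 0 -> z + d <= 0.
  have [z0|z0] := ltP z 0; first by exists (- z) => [|_]; lra.
  by exists 1.
elim: M x => [x|M IHM x].
  have [d d0 dP] := nil_discrete x.
  by exists d => // s fs; inversion fs.
have [d1 d10 dP1] := IHM x; have [d2 d20 dP2] := IHM (x - a M).
(* [d3] serves the empty sum, when [n = M.+1]. *)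
have [d3 d30 dP3] := nil_discrete x.
exists (Num.min d1 (Num.min d2 d3)); first by rewrite !lt_min d10 d20.
move=> s fs xs; have dle : [/\ Num.min d1 (Num.min d2 d3) <= d1,
    Num.min d1 (Num.min d2 d3) <= d2 & Num.min d1 (Num.min d2 d3) <= d3].
  by rewrite !ge_min !lexx !orbT.
case: dle => m1 m2 m3; inversion fs as [nE sE|M' s' fs' ME sE|M' s' fs' ME sE].
- by have := dP3; lra.
- by have := dP1 _ fs' xs; lra.
- by have := dP2 s' fs'; lra.
Qed.

(** Truncate at an index whose tail is shorter than [x - g]: the truncation of [x] lies in []g, x]],
    so it is [x]. That of a point slightly right of [x] can lie neither left of [x], by the same
    bound, nor right of it, by discreteness. *)
Lemma subsums_left_isolated {x g} : subsums 1 x -> g < x ->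
    (forall y, g < y < x -> ~ subsums 1 y) ->
  exists N, [/\ (0 < N)%N, forall t, subsums N t -> subsums 1 (x + t) &
    exists2 d, 0 < d &
      forall y, x <= y < x + d -> subsums 1 y -> subsums N (y - x)].
Proof.
move=> Ex gx gapP; have [N NP] := tail_sum_lt (x - g) ltac:(lra).
have finite_in s : finite_subsum 1 (1 + N) s -> subsums 1 s.
  by move=> fs; rewrite -[s]addr0; apply: (subsums_cat _ fs) => //; exact: subsums0.
have rN := NP (1 + N)%N (leq_addl _ _).
have fx : finite_subsum 1 (1 + N) x.
  have [s fs sx] := subsums_split N Ex.
  have /andP[? ?] := subsums_bounds sx.
  have xs : x <= s.
    by rewrite leNgt; apply/negP => sx0; apply: (gapP s) (finite_in s fs); lra.
  by have -> : x = s by lra.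
exists (1 + N)%N; split=> //; first by move=> t; exact: subsums_cat.
have [d d0 dP] := finite_subsum_discrete 1 (1 + N) x.
exists d => // y /andP[xy yd] Ey; have [s fs sy] := subsums_split N Ey.
have /andP[? ?] := subsums_bounds sy.
have [sx|xs|<- //] := ltgtP s x; last by have := dP s fs xs; lra.
have [gs|sg] := ltP g s; last by lra.
by exfalso; apply: (gapP s) (finite_in s fs); rewrite gs.
Qed.

(** * Gaps and intervals near one-sidedly isolated points *)

Hypothesis a_noninc : forall i j, (0 < i)%N -> (i <= j)%N -> a j <= a i.

Lemma subsums_widen {n k t} : (0 < n)%N -> (n <= k)%N -> subsums k t -> subsums n t.
Proof.
move=> n0 /subnKC <-; elim: (k - n)%N t => [|l IHl] t; first by rewrite addn0.
by rewrite addnS => /subsums_skip kt; apply/IHl/kt; rewrite addn_gt0 n0.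
Qed.

(** Taking a term of index at most [k] would cost at least [a k] and leave a negative remainder. *)
Lemma subsums_narrow {n k t} : (0 < n)%N -> (n <= k)%N -> t < a k -> subsums n t ->
  subsums k.+1 t.
Proof.
move=> n0 nk tk; have : (n <= k.+1)%N by exact: leqW.
move=> /subnKC <-; have : (k.+1 - n <= k.+1 - n)%N by [].
elim: {1 3}(k.+1 - n)%N => [|l IHl] lk nt; first by rewrite addn0.
have nl : (n + l <= k)%N by lia.
rewrite addnS; case: (subsumsS (IHl (ltnW lk) nt)) => // /subsums_bounds.
by have := a_noninc (n + l)%N k ltac:(lia) nl; lra.
Qed.

(** Besides positivity, summability and monotonicity, this is the only property of the sequence that
    the topological argument uses. *)
Hypothesis interval_beyond_gap : forall N, exists k, [/\ (N <= k)%N, (0 < k)%N,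
  tail_sum k.+1 < a k & exists u v, u < v /\ forall y, u <= y <= v -> subsums k.+1 y].

Definition near_gap (D : set R) (p q : R) := exists l w h,
  [/\ p < l < w, w < h < q, D l, D h & ~ D w].

Definition near_interval (D : set R) (p q : R) := exists l u v h,
  [/\ p < l < u, u < v, v < h < q, ~ D l /\ ~ D h & forall y, u <= y <= v -> D y].

Lemma a_lt e : 0 < e -> exists2 N, (0 < N)%N & forall n, (N <= n)%N -> a n < e.
Proof.
move=> /tail_sum_lt[N NP]; exists N.+1 => // n Nn.
have := NP n (ltnW Nn); have := tail_sumS n.
by have := tail_sum_ge0 n.+1 isT; lra.
Qed.

Lemma subsums_left_isolated_near {x g e} : subsums 1 x -> g < x ->
    (forall y, g < y < x -> ~ subsums 1 y) -> 0 < e ->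
  near_gap (subsums 1) x (x + e) /\ near_interval (subsums 1) (x - e) (x + e).
Proof.
move=> Ex gx gapP e0.
have [N [N0 addx [d d0 subx]]] := subsums_left_isolated Ex gx gapP.
have [M1 M10 aM1] := a_lt d d0; have [M2 M20 aM2] := a_lt e e0.
have kin k t : (N <= k)%N -> subsums k.+1 t -> subsums 1 (x + t).
  by move=> Nk tk; apply: addx; apply: subsums_widen tk => //; exact: leqW.
(* An offset below [a k] uses no term up to [k], so it is at most [tail_sum k.+1]; the translate of
   []tail_sum k.+1, a k[] by [x] misses the set. *)
have kout k y : (N <= k)%N -> a k < d -> tail_sum k.+1 < y - x < a k -> ~ subsums 1 y.
  move=> Nk kd yx Ey; have /andP[ylo yhi] := yx.
  have r0 := tail_sum_ge0 k.+1 isT.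
  have /(subsums_narrow N0 Nk yhi)/subsums_bounds : subsums N (y - x) by apply: subx => //; lra.
  by lra.
have [k [kl k0 gk [u [v [uv uvE]]]]] := interval_beyond_gap (N + M1 + M2)%N.
have kd : a k < d by apply: aM1; lia.
have ke : a k < e by apply: aM2; lia.
have Nk : (N <= k)%N by lia.
have r0 : 0 < tail_sum k.+1.
  by rewrite tail_sumS ltr_wpDr ?a_gt0 // tail_sum_ge0.
split; last first.
  have /subsums_bounds ub : subsums k.+1 u by apply: uvE; lra.
  have /subsums_bounds vb : subsums k.+1 v by apply: uvE; lra.
  (* The interval may start at [x] itself, so the left witness is taken in the empty []g, x[]; the
     right one is the middle of the translated gap. *)
  exists (Num.max (x - e / 2) ((x + g) / 2)), (x + u), (x + v), (x + (tail_sum k.+1 + a k) / 2).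
  have lx : Num.max (x - e / 2) ((x + g) / 2) < x by rewrite gt_max; lra.
  have l1 : x - e / 2 <= Num.max (x - e / 2) ((x + g) / 2) by rewrite le_max lexx.
  have l2 : (x + g) / 2 <= Num.max (x - e / 2) ((x + g) / 2).
    by rewrite le_max lexx orbT.
  split; [lra|lra|lra|split|].
  - by apply: gapP; lra.
  - by apply: (kout k) => //; lra.
  - move=> y yuv; rewrite -[y](subrKC x); apply: (kin k) => //; apply: uvE; lra.
exists (x + tail_sum k.+1), (x + (tail_sum k.+1 + a k) / 2), (x + a k).
split; [lra|lra| | |].
- apply: (kin k) => //; rewrite -[X in subsums _ X]subr0.
  by apply: subsums_reflect => //; exact: subsums0.
- apply: addx; apply: (subsums_widen (k := k)) => //.
  by rewrite -[a k]add0r; apply: subsums_take => //; exact: subsums0.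
- by apply: (kout k) => //; lra.
Qed.

Lemma subsums_right_isolated_near {x g e} : subsums 1 x -> x < g ->
    (forall y, x < y < g -> ~ subsums 1 y) -> 0 < e ->
  near_gap (subsums 1) (x - e) x /\ near_interval (subsums 1) (x - e) (x + e).
Proof.
move=> Ex xg gapP e0; set S := tail_sum 1.
have Erefl y : subsums 1 y -> subsums 1 (S - y) by exact: subsums_reflect.
have Enrefl y : ~ subsums 1 y -> ~ subsums 1 (S - y).
  by move=> nEy /Erefl; rewrite opprB addrCA subrr addr0.
have [||||[l [w [h [lw wh Dl Dh Dw]]]] [l' [u [v [h' [lu uv vh [Dl' Dh'] Duv]]]]]] :=
  @subsums_left_isolated_near (S - x) (S - g) e.
- exact: Erefl.
- by lra.
- move=> y yP; rewrite -[y](subKr S); apply/Enrefl/gapP; lra.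
- by [].
split.
  by exists (S - h), (S - w), (S - l); split; [lra|lra|exact: Erefl|exact: Erefl|exact: Enrefl].
exists (S - h'), (S - v), (S - u), (S - l'); split; [lra|lra|lra|split; exact: Enrefl|].
by move=> y yuv; rewrite -[y](subKr S); apply/Erefl/Duv; lra.
Qed.

(** Truncations approximate a point; a point equal to its own truncation is approached by adding one
    far term instead. *)
Lemma subsums_perfect : perfect_set (subsums 1).
Proof.
have Ecl := subsums_closed 1; split=> //; apply/seteqP; split=> x.
  move=> limx; apply: Ecl => U /limx[y [_ Ey Uy]]; by exists y.
move=> Ex U /nbhs_ballP[e /= e0 eU]; have [N NP] := tail_sum_lt e e0.
have rN := NP (1 + N)%N (leq_addl _ _).
have [s fs sx] := subsums_split N Ex.
have Es t : subsums (1 + N) t -> subsums 1 (s + t) by exact: subsums_cat.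
have aN : subsums (1 + N) (a (1 + N)%N).
  by rewrite -[a _]add0r; apply: subsums_take => //; exact: subsums0.
have /andP[x0 xr] := subsums_bounds sx; have /andP[a0 ar] := subsums_bounds aN.
have aN0 := a_gt0 (1 + N)%N isT.
have [xs|xs] := eqVneq x s.
  exists (s + a (1 + N)%N); split; [|exact: Es|apply: eU].
    by rewrite xs -subr_eq0 addrAC subrr add0r gt_eqF.
  by rewrite /ball /= xs opprD addNKr normrN ger0_norm //; lra.
exists s; split; first by rewrite eq_sym.
  by rewrite -[s]addr0; apply: Es; exact: subsums0.
by apply: eU; rewrite /ball /= ger0_norm //; lra.
Qed.

Lemma subsums_compact : compact (subsums 1).
Proof.
apply: (subclosed_compact _ (@segment_compact _ 0 (tail_sum 1))).
  exact: subsums_closed.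
by move=> x /subsums_bounds; rewrite /= in_itv.
Qed.

(** That [G] misses []p, q[] makes the trapped gap different from [G]. *)
Lemma near_gap_accumulation {D G U : set R} {p q} : near_gap D p q ->
    (forall y, p < y < q -> ~ G y) -> (forall y, p < y < q -> U y) ->
  exists2 S, (gaps D `\ G) S & S `<=` U.
Proof.
move=> [l [w [h [/andP[pl lw] /andP[wh hq] Dl Dh Dw]]]] nG sU.
have gw : gaps D (connected_component (~` D) w) by exists w.
have ww : connected_component (~` D) w w by exact: connected_component_refl.
exists (connected_component (~` D) w).
  split=> // wG; apply: (nG w); last by rewrite -wG.
  by rewrite (lt_trans pl) // (lt_trans wh).
have trap : connected_component (~` D) w `<=` `]l, h[%classic.
  apply: (components_trapped gw ww (fun nDl => nDl Dl) (fun nDh => nDh Dh)).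
  by rewrite lw.
move=> y /trap /=; rewrite in_itv /= => /andP[ly yh].
by apply: sU; rewrite (lt_trans pl) // (lt_trans yh).
Qed.

Lemma near_interval_accumulation {D U : set R} {p q} : near_interval D p q ->
    (forall y, p < y < q -> U y) ->
  exists2 S, nontrivial_components D S & S `<=` U.
Proof.
move=> [l [u [v [h [/andP[pl lu] uv /andP[vh hq] [Dl Dh] Duv]]]]] sU.
have cu : components D (connected_component D u).
  by exists u => //; apply: Duv; rewrite lexx ltW.
have uu : connected_component D u u.
  by apply: connected_component_refl; apply: Duv; rewrite lexx ltW.
have uvC : connected_component D u v by apply: connected_component_itv; rewrite ?ltW.
exists (connected_component D u).
  split=> // -[z zE]; move: uu uvC; rewrite zE => /= uz vz.
  by move: uv; rewrite uz vz ltxx.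
have trap : connected_component D u `<=` `]l, h[%classic.
  by apply: (components_trapped cu uu Dl Dh); rewrite lu (lt_trans uv).
move=> y /trap /=; rewrite in_itv /= => /andP[ly yh].
by apply: sU; rewrite (lt_trans pl) // (lt_trans yh).
Qed.

(** At the lower endpoint of [G] other gaps are sought on the left, where [G] has no points, and at
    the upper endpoint on the right. *)
Lemma subsums_cantorval : cantorval (subsums 1).
Proof.
have Ecl := subsums_closed 1.
split; [exact: subsums_compact|exact: subsums_perfect|].
have inU (x e p q : R) (U : set R) : ball x e `<=` U -> x - e <= p -> q <= x + e ->
    forall y, p < y < q -> U y.
  move=> eU xp qx y /andP[py yq]; apply: eU.
  by rewrite /ball /= ltr_norml; lra.
move=> G x gG [[hG ->]|[hG ->]]; split=> U /nbhs_ballP[e /= e0 eU].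
- have [Ex [g xg gapP]] := gap_inf Ecl gG hG.
  have [ng _] := subsums_right_isolated_near Ex xg gapP e0.
  apply: (near_gap_accumulation ng); last by apply: (inU _ _ _ _ _ eU); lra.
  by move=> y /andP[_ yG] /(ge_inf hG.2); rewrite leNgt yG.
- have [Ex [g xg gapP]] := gap_inf Ecl gG hG.
  have [_ ni] := subsums_right_isolated_near Ex xg gapP e0.
  exact: near_interval_accumulation ni (inU _ _ _ _ _ eU _ _).
- have [Ex [g gx gapP]] := gap_sup Ecl gG hG.
  have [ng _] := subsums_left_isolated_near Ex gx gapP e0.
  apply: (near_gap_accumulation ng); last by apply: (inU _ _ _ _ _ eU); lra.
  by move=> y /andP[yG _] /(ub_le_sup hG.2); rewrite leNgt yG.
- have [Ex [g gx gapP]] := gap_sup Ecl gG hG.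
  have [_ ni] := subsums_left_isolated_near Ex gx gapP e0.
  exact: near_interval_accumulation ni (inU _ _ _ _ _ eU _ _).
Qed.

End Subsums.

(** * The block sequence *)
Section Blocks.
Variables k m : nat -> nat.
Hypotheses (k0 : k 0%N = 0%N) (m0 : m 0%N = 1%N).
Hypothesis m_pos : forall n, (1 <= n)%N -> (1 <= m n)%N.
Hypothesis k1 : (1 < k 1%N)%N.
Hypothesis k_gap : forall n, (1 <= n)%N -> (k n.+1 > k n + m n)%N.

(** With [k 0 = 0] and [m 0 = 1] this is [0] at [N = 0], so the ranges
    [block_end N < i <= block_end N.+1] partition the positive indices, each ending with a block. *)
Definition block_end (N : nat) : nat := k N + m N - 1.

Lemma block_end0 : block_end 0 = 0%N.
Proof. by rewrite /block_end k0 m0. Qed.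

Lemma block_end_lt_k N : ((block_end N).+1 < k N.+1)%N.
Proof.
case: N => [|N]; first by rewrite /block_end k0 m0.
by have := k_gap N.+1 isT; have := m_pos N.+1 isT; rewrite /block_end; lia.
Qed.

Lemma k_le_block_end N : (k N.+1 <= block_end N.+1)%N.
Proof. by have := m_pos N.+1 isT; rewrite /block_end; lia. Qed.

Lemma block_end_incr M N : (M <= N)%N -> (block_end M + (N - M) <= block_end N)%N.
Proof.
move=> /subnKC <-; rewrite addKn; elim: (N - M)%N => [|l IHl]; first by rewrite !addn0.
have := block_end_lt_k (M + l)%N; have := k_le_block_end (M + l)%N.
by rewrite !addnS; lia.
Qed.

Lemma in_block {i} : (0 < i)%N -> exists N, (block_end N < i <= block_end N.+1)%N.
Proof.
case: i => // i _; elim: i => [|i [N /andP[Ni iN]]].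
  exists 0%N; have := k_le_block_end 0; have := block_end_lt_k 0; rewrite block_end0; lia.
have [iN'|Ni'] := ltnP i.+1 (block_end N.+1); first by exists N; lia.
by exists N.+1; have := block_end_lt_k N.+1; have := k_le_block_end N.+1; lia.
Qed.

Lemma KsetE {N i} : (block_end N < i <= block_end N.+1)%N ->
  Kset k m i <-> (k N.+1 <= i)%N.
Proof.
move=> /andP[Ni iN]; split=> [[n /= n1 /andP[kn nk]]|ki]; last first.
  by exists N.+1 => //=; rewrite /Kblock /= ki.
case: n n1 kn nk => // n _ kn nk.
have [nN|Nn|<- //] := ltgtP n N; last first.
  by have := block_end_incr N.+1 n Nn; have := block_end_lt_k n; lia.
by have := block_end_incr n.+1 N nN; rewrite /block_end in Ni *; lia.
Qed.

(** * Closed form of the recurrence *)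

Section Dyadic.
Context {R : realType}.
Variable a : nat -> R.

Definition block_coef (N i : nat) : R :=
  if (i.+1 < k N.+1)%N then 1
  else if (i < k N.+1)%N then 1 + 2 ^- m N.+1 else 2.

Lemma block_coef_gt0 N i : 0 < block_coef N i.
Proof. by rewrite /block_coef; do 2 case: ifP => // _. Qed.

(** Every factor of the recurrence is one half times the quotient of consecutive coefficients; for
    instance [1 / 4] passes from [2] to [1]. *)
Lemma K_recurrence_closed_form : K_recurrence k m a -> 0 < a 1%N ->
  exists2 C, 0 < C & forall N i, (block_end N < i <= block_end N.+1)%N ->
    a i = C / 2 ^+ i * block_coef N i.
Proof.
(* [C] makes the formula exact at [i = 1], where the coefficient exceeds [1] if [k 1 = 2]. *)
move=> a_rec a1; exists (2 * a 1%N / block_coef 0 1).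
  by rewrite divr_gt0 ?mulr_gt0 // block_coef_gt0.
set C := _ / _; move=> N i; elim: i N => [|[|i] IHi] N Ni; first by lia.
  have -> : N = 0%N.
    case: N Ni => // N; have := block_end_lt_k N; have := k_le_block_end N; lia.
  by rewrite /C expr1; have := block_coef_gt0 0 1; move: (block_coef _ _) => g g0; field; lra.
have p2 j : (2 : R) ^+ j != 0 by rewrite expf_neq0.
have p2m j : (2 : R) ^+ j + 1 != 0 by rewrite gt_eqF // addr_gt0 // exprn_gt0.
have Ni' := k_le_block_end N; have Nk := block_end_lt_k N.
have [K1 K2 K3 K4 K5] := a_rec i.+2 isT.
have notK j : (block_end N < j < k N.+1)%N -> ~ Kset k m j.
  by move=> jN; rewrite (@KsetE N); lia.
have inK j : (k N.+1 <= j <= block_end N.+1)%N -> Kset k m j.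
  by move=> jN; rewrite (@KsetE N); lia.
have [Nlt|iN] := ltnP (block_end N) i.+1.
  have aI : a i.+1 = C / 2 ^+ i.+1 * block_coef N i.+1 by apply: IHi; lia.
  rewrite /block_coef in aI *; move: aI.
  case: (ltngtP i.+3 (k N.+1)) => ik.
  - move=> /= aI; rewrite K1; last by left; split; [|split]; apply: notK; lia.
    by rewrite /= aI [2 ^+ i.+2]exprS; field.
  - have [ik1|ik1] := ltnP i.+1 (k N.+1) => aI.
      rewrite (K4 N.+1) //=; last by lia.
      by rewrite aI [2 ^+ i.+2]exprS; field; rewrite p2m !p2.
    rewrite K1; last by right; split; apply: inK; lia.
    by rewrite /= aI [2 ^+ i.+2]exprS; field.
  - move=> /= aI; rewrite (K2 N.+1) //=; [|lia|].
      by rewrite aI addn1 !exprS; field; rewrite !p2.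
    by rewrite /block_end in Nlt; lia.
(* Otherwise [i.+1] is the last index of the preceding block, with coefficient [2]. *)
have iE : i.+1 = block_end N by lia.
case: N => [|N] in Ni Ni' Nk notK inK iN iE *.
  by move: iE; rewrite /block_end k0 m0.
have aI : a i.+1 = C / 2 ^+ i.+1 * 2.
  have := k_le_block_end N; have := block_end_lt_k N => kN Nk'.
  rewrite (IHi N) ?iE; last by lia.
  by rewrite /block_coef; do 2 (case: ifP => ?; first by lia).
have Ki : Kset k m i.+1.
  exists N.+1 => //=; rewrite /Kblock /=.
  by have := k_le_block_end N; rewrite /block_end in iE *; lia.
have mN := m_pos N.+1 isT.
rewrite /block_coef; case: (ltngtP i.+3 (k N.+2)) => ik; last first.
- rewrite /= (K3 N.+2) //=; [|lia|rewrite /block_end in iE; lia].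
  by rewrite aI addn2 !exprS; field; rewrite !p2.
- by lia.
- rewrite K5; last by split; [|split] => //; apply: notK; lia.
  by rewrite /= aI !exprS; field.
Qed.

(** * Comparison of the terms with their tails *)

Variable C : R.
Hypothesis C0 : 0 < C.
Hypothesis a_closed_form : forall N i, (block_end N < i <= block_end N.+1)%N ->
  a i = C / 2 ^+ i * block_coef N i.

Definition unit_at (i : nat) : R := C / 2 ^+ i.

Lemma unit_at_gt0 i : 0 < unit_at i.
Proof. by rewrite divr_gt0 // exprn_gt0. Qed.

Lemma unit_atD i l : unit_at i = 2 ^+ l * unit_at (i + l).
Proof.
by rewrite /unit_at exprD; field; rewrite !expf_neq0.
Qed.

Lemma unit_atS i : unit_at i = 2 * unit_at i.+1.
Proof. by rewrite (unit_atD i 1) expr1 addn1. Qed.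

Lemma unit_at_le {i j} : (i <= j)%N -> unit_at j <= unit_at i.
Proof.
move=> /subnKC <-; rewrite (unit_atD i (j - i)) ler_peMl ?(ltW (unit_at_gt0 _)) //.
by apply: exprn_ege1; rewrite ler1n.
Qed.

Lemma unit_at_cvg : unit_at @ \oo --> 0.
Proof.
have -> : unit_at = geometric C 2^-1 by apply/funext => i; rewrite /unit_at /= exprVn.
by apply: cvg_geometric; rewrite ger0_norm // invf_lt1 // ltr1n.
Qed.

Lemma a_plain {N i} : (block_end N < i)%N -> (i.+1 < k N.+1)%N -> a i = unit_at i.
Proof.
move=> Ni ik; rewrite (@a_closed_form N); last by have := k_le_block_end N; lia.
by rewrite /block_coef ik mulr1.
Qed.

Lemma a_before_block {N i} : i.+1 = k N.+1 -> a i = (1 + 2 ^- m N.+1) * unit_at i.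
Proof.
move=> ik; rewrite (@a_closed_form N); last first.
  by have := k_le_block_end N; have := block_end_lt_k N; lia.
by rewrite /block_coef ik ltnn -ik ltnSn mulrC.
Qed.

Lemma a_in_block {N i} : (k N.+1 <= i <= block_end N.+1)%N -> a i = 2 * unit_at i.
Proof.
move=> /andP[ki iN]; rewrite (@a_closed_form N); last first.
  by have := block_end_lt_k N; lia.
by rewrite /block_coef !ltnNge ki (leqW ki) mulrC.
Qed.

(** Coefficients lie between [1] and [2]; as the unit halves at each index, this already gives
    positivity, monotonicity and summability. *)
Lemma a_bounds {i} : (0 < i)%N -> unit_at i <= a i <= 2 * unit_at i.
Proof.
move=> /in_block[N Ni]; rewrite (a_closed_form _ _ Ni) -/(unit_at i) mulrC.
have u0 := unit_at_gt0 i; have p1 : (1 : R) <= 2 ^+ m N.+1 by rewrite exprn_ege1 // ler1n.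
have [? ?] : 1 <= block_coef N i /\ block_coef N i <= 2 :> R.
  rewrite /block_coef; case: ifP => _; first by lra.
  case: ifP => _; last by lra.
  have : 0 <= 2 ^- m N.+1 :> R by rewrite invr_ge0 (le_trans _ p1).
  have : 2 ^- m N.+1 <= 1 :> R by rewrite invf_le1 // (lt_le_trans _ p1).
  by lra.
by apply/andP; split; nra.
Qed.

Lemma a_gt0 i : (0 < i)%N -> 0 < a i.
Proof. by move=> /a_bounds/andP[+ _]; apply: lt_le_trans; exact: unit_at_gt0. Qed.

Lemma a_noninc i j : (0 < i)%N -> (i <= j)%N -> a j <= a i.
Proof.
move=> i0; rewrite leq_eqVlt => /predU1P[-> //|ij].
have /andP[_ aj] := a_bounds (ltn_trans i0 ij); have /andP[ai _] := a_bounds i0.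
apply: le_trans aj (le_trans _ ai); have := unit_at_le ij; rewrite (unit_atS i).
by lra.
Qed.

Lemma a_summable : cvgn (series a).
Proof.
(* Nothing bounds [a 0], so it is replaced by [0] before the comparison with a geometric series. *)
pose b i := if i is 0 then 0 else a i.
have : cvgn (series b).
  apply: (@series_le_cvg _ _ (geometric (2 * C) 2^-1)).
  - by case=> // i; exact/ltW/a_gt0.
  - by move=> i /=; rewrite mulr_ge0 ?exprn_ge0 ?mulr_ge0 // ltW.
  - case=> [|i] /=; first by rewrite mulr_ge0 ?exprn_ge0 ?mulr_ge0 // ltW.
    have /andP[_] := @a_bounds i.+1 isT.
    by rewrite /unit_at exprVn mulrA.
  - by apply: is_cvg_geometric_series; rewrite ger0_norm // invf_lt1 // ltr1n.
rewrite -(is_cvg_series_restrict 1) -(is_cvg_series_restrict 1 a).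
suff -> : (fun n => \sum_(1 <= i < n) b i) = (fun n => \sum_(1 <= i < n) a i) by [].
by apply/funext => n; apply: eq_big_nat => -[].
Qed.

Local Notation tail := (tail_sum a).
Let tailS := tail_sumS a.

Lemma tail_ge {i} : (0 < i)%N -> 2 * unit_at i <= tail i.
Proof.
move=> i0; apply: (tail_sum_ge a a_summable (fun j => 2 * unit_at j)).
  by rewrite -(mulr0 2); apply: cvgM; [exact: cvg_cst|exact: unit_at_cvg].
move=> j ij; rewrite -unit_atS; have /andP[] := a_bounds (leq_trans i0 ij); lra.
Qed.

(** The subtracted [2 * unit_at i] is the tail of the geometric sequence [unit_at] from index [i]
    on. *)
Definition excess (i : nat) : R := tail i - 2 * unit_at i.

Lemma excess_plain N l : (block_end N + l.+1 < k N.+1)%N ->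
  excess (block_end N).+1 = excess (block_end N + l.+1).
Proof.
elim: l => [|l IHl] kl; first by rewrite addn1.
rewrite IHl ?addnS; last by lia.
rewrite /excess tailS (@a_plain N) ?(unit_atS (block_end N + l).+1); [ring|lia|lia].
Qed.

(** Each block term after the first is half the previous one, so r_i - a_i is constant along the
    block and can be evaluated at its end. *)
Lemma tail_in_block N l i : (k N.+1 <= i)%N -> (i + l <= block_end N.+1)%N ->
  tail i.+1 - 2 * unit_at i = tail (i + l).+1 - 2 * unit_at (i + l).
Proof.
move=> ki; elim: l => [|l IHl] il; first by rewrite addn0.
rewrite IHl; last by lia.
rewrite addnS tailS (@a_in_block N) ?(unit_atS (i + l)); [ring|lia].
Qed.

(* The coefficient in front of a block and the doubled terms inside it together
   add [2^-m + (1 - 2^-m)] units of index [k N.+1 - 1] to the geometric tail. *)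
Lemma excess_block_end N :
  excess (block_end N).+1 = excess (block_end N.+1).+1 + unit_at (k N.+1).-1.
Proof.
have Nk := block_end_lt_k N; have kN := k_le_block_end N.
set q := (k N.+1).-1; have kE : k N.+1 = q.+1 by rewrite /q; lia.
have qE : q = (block_end N + (q - (block_end N).+1).+1)%N by lia.
rewrite (excess_plain N (q - (block_end N).+1)) -?qE; last by lia.
have := tail_in_block N (block_end N.+1 - q.+1) q.+1; rewrite kE subnKC; last by lia.
move=> /(_ (leqnn _) (leqnn _)).
rewrite /excess (unit_atS (block_end N.+1)) (tailS q) (a_before_block (esym kE)).
rewrite (tailS q.+1) (@a_in_block N q.+1); last by lia.
have -> : unit_at q.+1 = 2^-1 * unit_at q by rewrite (unit_atS q); field.
have -> : unit_at (block_end N.+1).+1 = 2 ^- m N.+1 / 2 * unit_at q.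
  rewrite (unit_atD q (m N.+1).+1) exprS; have -> : (block_end N.+1).+1 = (q + (m N.+1).+1)%N.
    by have := m_pos N.+1 isT; rewrite /block_end; lia.
  by field; rewrite expf_neq0.
by lra.
Qed.

(** The next block adds at most half of [unit_at (block_end N)], and the unit at its end is at most
    a quarter of that one; [2 / 3] solves [x = 1 / 2 + x / 4]. *)
Lemma excess_le N : excess (block_end N).+1 <= 2 / 3 * unit_at (block_end N).
Proof.
pose D M := 2 / 3 * unit_at (block_end M) - excess (block_end M).+1.
have Dstep M : D M.+1 <= D M.
  rewrite /D (excess_block_end M).
  have Nk := block_end_lt_k M; have kN := k_le_block_end M.
  have : unit_at (k M.+1).-1 <= unit_at (block_end M).+1 by apply: unit_at_le; lia.
  have : unit_at (block_end M.+1) <= unit_at (block_end M).+2 by apply: unit_at_le; lia.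
  rewrite (unit_atS (block_end M)) (unit_atS (block_end M).+1); lra.
have Ddrop l : D (N + l)%N <= D N.
  by elim: l => [|l IHl]; rewrite ?addn0 // addnS (le_trans (Dstep _)).
(* A negative [D N] would bound all later values of [D] from above, although the tails tend to
   [0]. *)
suff : 0 <= D N by rewrite subr_ge0.
rewrite leNgt; apply/negP => DN0.
have [M MP] := tail_sum_lt a a_summable (- D N) ltac:(lra).
have := Ddrop M; have := MP (block_end (N + M)%N).+1.
have := block_end_incr 0 (N + M)%N isT; rewrite block_end0 => NM.
move=> /(_ ltac:(lia)); rewrite {2}/D /excess.
by have := unit_at_gt0 (block_end (N + M)%N); have := unit_at_gt0 (block_end (N + M)%N).+1; lra.
Qed.

(** At the end of the block the excess over the geometric tail is at most [2 / 3] of a unit, while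
    the last term exceeds that tail by a whole unit. *)
Lemma tail_lt_in_block {N i} : (k N.+1 <= i <= block_end N.+1)%N -> tail i.+1 < a i.
Proof.
move=> /andP[ki iN]; rewrite (@a_in_block N) ?ki // -subr_lt0.
rewrite (tail_in_block N (block_end N.+1 - i)) ?subnKC //.
have := excess_le N.+1; have := unit_at_gt0 (block_end N.+1).
by rewrite /excess (unit_atS (block_end N.+1)); lra.
Qed.

Lemma a_le_tail {N i} : (block_end N < i)%N -> (i < k N.+1)%N -> a i <= tail i.+1.
Proof.
move=> Ni; rewrite leq_eqVlt => /predU1P[ik|ik].
  (* Just before a block, [a i] is at most [3 / 2] of its unit because the block is nonempty; the
     first block term with the geometric tail after it amounts to exactly that. *)
  have kN := k_le_block_end N.
  have := @tail_ge i.+2 isT; rewrite (a_before_block ik) (tailS i.+1) (@a_in_block N i.+1); last by lia.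
  have p2 : 2 ^- m N.+1 <= 2^-1 :> R.
    have := m_pos N.+1 isT; case: (m N.+1) => // n _.
    by rewrite exprS invfM ler_piMr // invf_le1 ?exprn_gt0 // exprn_ege1 // ler1n.
  have := unit_at_gt0 i.+2; rewrite (unit_atS i) (unit_atS i.+1); nra.
by rewrite (@a_plain N) // unit_atS; exact: tail_ge.
Qed.

Lemma remainder_lt_KsetP n : (1 <= n)%N ->
  ((a n)%:E > remainder a n)%E <-> Kset k m n.
Proof.
move=> n1; have [N Nn] := in_block n1; rewrite (KsetE Nn) remainderE ?lte_fin //; last first.
  exact: a_summable.
split=> [lt_an|kn]; last by apply: (@tail_lt_in_block N); rewrite kn; case/andP: Nn.
rewrite leqNgt; apply/negP => nk; case/andP: Nn => Nn _.
by have := a_le_tail Nn nk; lra.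
Qed.

(** * Runs of lattice points and an interval in the tail sets *)

Lemma natr_half t : t%:R = (odd t)%:R + 2 * t./2%:R :> R.
Proof. by rewrite -{1}(odd_double_half t) natrD -muln2 natrM mulrC. Qed.

(** Points are counted downwards from [b], itself excluded; refinement keeps [b] and changes only
    the unit and the length. *)
Definition lattice_run (n i w : nat) (b : R) : Prop := forall t, (1 <= t <= w)%N ->
  finite_subsum a n i.+1 (b - t%:R * unit_at i).

(** The added term is the new unit: even multiples are old points, and an odd one is the old point
    just below it plus this term. *)
Lemma lattice_run_plain n i w b : a i.+1 = unit_at i.+1 -> lattice_run n i w b ->
  lattice_run n i.+1 (2 * w) b.
Proof.
move=> ai run t tw; have := natr_half t.
case: (boolP (odd t)) => [t1|t0] ->.
  have -> : b - (1 + 2 * t./2%:R) * unit_at i.+1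
      = b - t./2.+1%:R * unit_at i + a i.+1.
    by rewrite ai (unit_atS i) -(natr1 t./2); ring.
  by apply/finite_subsum_take/run; lia.
have -> : b - (0 + 2 * t./2%:R) * unit_at i.+1 = b - t./2%:R * unit_at i.
  by rewrite (unit_atS i); ring.
by apply/finite_subsum_skip/run; lia.
Qed.

Lemma lattice_run_plains N n w b l : (block_end N + l.+1 < k N.+1)%N ->
  lattice_run n (block_end N) w b -> lattice_run n (block_end N + l) (2 ^ l * w) b.
Proof.
move=> + run; elim: l => [|l IHl] kl; first by rewrite addn0 mul1n.
rewrite addnS expnS -mulnA; apply: lattice_run_plain; last by apply: IHl; lia.
by apply: (@a_plain N); lia.
Qed.

(** In units of [2 * unit_at (block_end N.+1)] the block terms are consecutive powers of two ending
    at [1], so they spell [j] in binary. *)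
Lemma block_digits N n s : finite_subsum a n (k N.+1) s -> forall j, (j < 2 ^ m N.+1)%N ->
  finite_subsum a n (block_end N.+1).+1 (s + j%:R * (2 * unit_at (block_end N.+1))).
Proof.
move=> fs; rewrite (unit_atS (block_end N.+1)).
have kE : (block_end N.+1).+1 = (k N.+1 + m N.+1)%N.
  by have := k_le_block_end N; have := m_pos N.+1 isT; rewrite /block_end; lia.
rewrite kE; have : (m N.+1 <= m N.+1)%N by [].
elim: {1 3 4 5}(m N.+1) => [_ j|l IHl lm j jl].
  by rewrite expn0 ltnS leqn0 => /eqP ->; rewrite mul0r addr0 addn0.
have al : a (k N.+1 + l)%N = 4 * unit_at (k N.+1 + l).+1.
  by rewrite (@a_in_block N); [rewrite unit_atS; ring|lia].
have half_lt : (j./2 < 2 ^ l)%N by move: jl; rewrite expnS; lia.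
rewrite addnS; have := IHl (ltnW lm) _ half_lt; rewrite (unit_atS (k N.+1 + l)).
rewrite (natr_half j); case: (odd j) => [/finite_subsum_take|/finite_subsum_skip];
  congr (finite_subsum _ _ _ _).
  by rewrite al /=; ring.
by rewrite /=; ring.
Qed.

Lemma round_up (P s w : nat) : (0 < P)%N -> (1 <= s <= P * w)%N ->
  exists q j, [/\ s + j = P * q, j < P & 1 <= q <= w]%N.
Proof.
move=> P0 /andP[s1 sw]; exists (s.-1 %/ P).+1, (P - (s.-1 %% P).+1)%N.
have := divn_eq s.-1 P; have := ltn_pmod s.-1 P0.
have : (s.-1 %/ P < w)%N by rewrite ltn_divLR // mulnC; lia.
by move: (_ %/ _)%N (_ %% _)%N => q r; split; nia.
Qed.

(* The sums of the block and of the term before it form a complete residue system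
   modulo [2 ^ (m + 1)]: the even residues come without that term and lie below
   [2 ^ (m + 1)], the odd ones come with it and start at [2 ^ m + 1]. *)
Lemma lattice_run_block {N n w b} : lattice_run n (k N.+1).-2 w b ->
  lattice_run n (block_end N.+1) (2 ^ (m N.+1).+1 * w - 2 ^ m N.+1) b.
Proof.
have kN := block_end_lt_k N; have Nk := k_le_block_end N; have mN := m_pos N.+1 isT.
set i := (k N.+1).-2; have kE : k N.+1 = i.+2 by rewrite /i; lia.
set P := (2 ^ m N.+1)%N; have P0 : (0 < P)%N by rewrite expn_gt0.
have [P' PE] : exists P', P = (2 * P')%N.
  by exists (2 ^ (m N.+1).-1)%N; rewrite /P -expnS prednK.
have iE : (i.+1 + m N.+1)%N = block_end N.+1 by rewrite /block_end kE; lia.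
move=> run t tw; rewrite expnS -/P in tw.
have unitE : unit_at i.+1 = P%:R * unit_at (block_end N.+1).
  by rewrite (unit_atD i.+1 (m N.+1)) iE natrX.
move: unitE (@block_digits N n); set c := unit_at (block_end N.+1) => unitE digits.
rewrite kE in digits.
(* For odd [t] the aim is [t = 2 * P * q - (P + 1) - 2 * j], for even [t] the same without [P + 1].
   The odd case needs [t + P + 1 <= 2 * P * w], whence the lost [P] points. *)
have [q [j [sj jP qw]]] : exists q j, [/\ (t + odd t * P.+1)./2 + j = P * q, j < P & 1 <= q <= w]%N.
  by apply: round_up => //; case: (odd t) (odd_double_half t) => /=; nia.
have base : finite_subsum a n i.+2 (b - q%:R * (2 * (P%:R * c)) + (odd t)%:R * a i.+1).
  have := run q qw; rewrite (unit_atS i) unitE; case: (odd t) => fq.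
    by rewrite mul1r; exact: finite_subsum_take.
  by rewrite mul0r addr0; exact: finite_subsum_skip.
have := digits _ base j jP; congr (finite_subsum _ _ _ _).
have tE : (t + odd t * P.+1 + 2 * j)%N = (2 * (P * q))%N.
  by move: sj (odd_double_half t); case: (odd t) => /=; lia.
have {}tE : t%:R + (odd t)%:R * (P%:R + 1) + 2 * j%:R = 2 * (P%:R * q%:R) :> R.
  by have := congr1 (fun n : nat => n%:R : R) tE; rewrite /= !(natrD, natrM) -(natr1 P).
have -> : a i.+1 = (P%:R + 1) * c.
  have PX : P%:R = 2 ^+ m N.+1 :> R by rewrite natrX.
  by rewrite (@a_before_block N) // unitE PX; field; rewrite expf_neq0.
have -> : t%:R = 2 * (P%:R * q%:R) - (odd t)%:R * (P%:R + 1) - 2 * j%:R :> R by lra.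
by ring.
Qed.

(* A block shortens the run by half a unit of the lattice it starts from; the
   total loss stays below two thirds of the initial length. *)
Lemma lattice_run_from N l : exists2 w,
  lattice_run (block_end N).+1 (block_end (N + l)) w (unit_at (block_end N)) &
  1 / 3 * unit_at (block_end N) + 2 / 3 * unit_at (block_end (N + l))
    <= w%:R * unit_at (block_end (N + l)).
Proof.
elim: l => [|l [w run wP]].
  (* The run starts as the single point [0], the empty sum. *)
  exists 1%N; last by rewrite addn0; lra.
  move=> t /andP[t1 t2]; have -> : t = 1%N by lia.
  by rewrite addn0 mul1r subrr; exact: finite_subsum_nil.
set M := (N + l)%N in run wP *; rewrite addnS -/M.
have kM := block_end_lt_k M; have Mk := k_le_block_end M; have mM := m_pos M.+1 isT.
set d := ((k M.+1).-2 - block_end M)%N.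
have dE : (block_end M + d)%N = (k M.+1).-2 by rewrite /d; lia.
have := @lattice_run_plains M _ w _ d; move=> /(_ _ _ ltac:(lia) run); rewrite dE.
move=> /lattice_run_block run'; eexists; first exact: run'.
have w1 : (1 <= w)%N.
  rewrite lt0n; apply/eqP => w0; rewrite w0 mul0r in wP.
  by have := unit_at_gt0 (block_end N); have := unit_at_gt0 (block_end M); lra.
rewrite natrB; last first.
  apply: (leq_trans _ (leq_pmulr _ _)); first by rewrite leq_exp2l.
  by rewrite muln_gt0 expn_gt0 w1.
have kE : (k M.+1).-1 = (block_end M + d.+1)%N by lia.
have uk : unit_at (k M.+1).-1 = 2 ^+ m M.+1 * unit_at (block_end M.+1).
  by rewrite (unit_atD _ (m M.+1)) /block_end; congr (_ * unit_at _); lia.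
have uM : unit_at (block_end M) = 2 ^+ d.+1 * (2 ^+ m M.+1 * unit_at (block_end M.+1)).
  by rewrite (unit_atD _ d.+1) -kE uk.
(* The block costs at most half of [unit_at (block_end M)]; of the reserve [2 / 3], the remaining
   [1 / 6] covers [2 / 3] of the next unit, which is at most a quarter of this one. *)
have uM1 : unit_at (k M.+1).-1 <= unit_at (block_end M).+1 by apply: unit_at_le; lia.
have uM2 : unit_at (block_end M.+1) <= unit_at (block_end M).+2 by apply: unit_at_le; lia.
have -> : ((2 ^ (m M.+1).+1 * (2 ^ d * w))%:R - (2 ^ m M.+1)%:R) * unit_at (block_end M.+1)
   = w%:R * unit_at (block_end M) - 2 ^+ m M.+1 * unit_at (block_end M.+1) :> R.
  by rewrite uM !natrM !natrX !exprS; ring.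
by rewrite (unit_atS (block_end M)) (unit_atS (block_end M).+1) in wP uM1 uM2 *; rewrite uk in uM1; lra.
Qed.

(** The runs reach from [b] down to [2 / 3 * b] or lower with ever finer units, so their points are
    dense there, and the set is closed. The bound [5 / 6 * b] keeps [y] more than one fine unit
    below [b], which the run excludes. *)
Lemma subsums_interval N y :
  2 / 3 * unit_at (block_end N) <= y <= 5 / 6 * unit_at (block_end N) ->
  subsums a (block_end N).+1 y.
Proof.
set b := unit_at _ => /andP[yl yu].
have b0 : 0 < b by exact: unit_at_gt0.
apply: (iffLR (closed_distP _) (subsums_closed a _)) => e e0.
have [M [Me Mb]] : exists M, unit_at (block_end (N + M)) < e /\
    unit_at (block_end (N + M)) < b / 6.
  have /cvgr0Pnorm_lt/(_ (Num.min e (b / 6)))[|M _ MP] := unit_at_cvg.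
    by rewrite lt_min e0 divr_gt0.
  exists M; apply/andP; rewrite -lt_min; apply: le_lt_trans (MP _ _); first exact: ler_norm.
  by have := block_end_incr 0 (N + M) isT; rewrite block_end0 /=; lia.
have [w run wP] := lattice_run_from N M; set c := unit_at (block_end (N + M)) in Me Mb wP *.
have c0 : 0 < c by exact: unit_at_gt0.
have x0 : 0 <= (b - y) / c by rewrite divr_ge0 ?ltW //; lra.
have /andP[tl tu] := truncn_itv x0; set t := Num.truncn _ in tl tu.
have tl' : t%:R * c <= b - y by rewrite -ler_pdivlMr.
have tu' : b - y < t%:R * c + c by move: tu; rewrite ltr_pdivrMr // -natr1 mulrDl mul1r.
have t1 : (1 <= t)%N.
  by rewrite lt0n; apply/eqP => t0; rewrite t0 mul0r in tu'; lra.
have tw : (t <= w)%N.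
  by rewrite -(ler_nat R) -(ler_pM2r c0); rewrite -/b in wP; lra.
exists (b - t%:R * c); last by rewrite ltr_norml; apply/andP; split; lra.
have fs := run t ltac:(by rewrite t1); rewrite -[X in subsums _ _ X]addr0.
exact: (subsums_cat a a_gt0 (ltn0Sn _) fs (subsums0 a a_gt0 a_summable (ltn0Sn _))).
Qed.

(** The last index of a block gives both the gap, being in K, and the interval among the sums of
    later terms. *)
Lemma achievement_set_cantorval : cantorval (achievement_set a).
Proof.
rewrite achievement_setE; [|exact: a_gt0|exact: a_summable].
apply: subsums_cantorval; [exact: a_gt0|exact: a_summable|exact: a_noninc|].
move=> N; have Nk := k_le_block_end N; have := block_end_incr 0 N.+1 isT.
rewrite block_end0 => NN; exists (block_end N.+1); split; [lia|lia| |].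
  by apply: (@tail_lt_in_block N); rewrite Nk leqnn.
exists (2 / 3 * unit_at (block_end N.+1)), (5 / 6 * unit_at (block_end N.+1)); split.
  by have := unit_at_gt0 (block_end N.+1); lra.
exact: subsums_interval.
Qed.

End Dyadic.
End Blocks.

Theorem theorem4p1 (R : realType) (k m : nat -> nat) (a : nat -> R)
  (k0 : k 0%N = 0%N) (m0 : m 0%N = 1%N)
  (k_pos : forall n : nat, (1 <= n)%N -> (1 <= k n)%N)
  (m_pos : forall n : nat, (1 <= n)%N -> (1 <= m n)%N)
  (k1 : (1 < k 1%N)%N)
  (k_gap : forall n : nat, (1 <= n)%N -> (k n.+1 > k n + m n)%N)
  (a1 : 0 < a 1%N)
  (a_rec : K_recurrence k m a) :
  (forall n : nat, (1 <= n)%N ->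
     (((a n)%:E > remainder a n)%E <-> Kset k m n)) /\
  cantorval (achievement_set a).
Proof.
have [C C0 aC] := K_recurrence_closed_form k m k0 m0 m_pos k1 k_gap a a_rec a1.
split; first exact: remainder_lt_KsetP C0 aC.
exact: achievement_set_cantorval C0 aC.
Qed.
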